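(* Let $B$ be a finite Blaschke product of degree $n\ge 1$, and let $M=M(B)$, $m=m(B)$. Then \[ \frac{n}{M-n+1}\le m\le n-1+\frac{n}{M} \qquad\text{and}\qquad 0<m\le n\le M . \]
   Context: A finite Blaschke product of degree $n$ is a function $B(z)=\alpha\prod_{k=1}^n \frac{z-a_k}{1-\overline{a_k}z}$ with $a_1,\dots,a_n\in\mathbb D=\{|z|<1\}$ and $\alpha\in\mathbb T=\{|z|=1\}$. For such $B$, $M(B)=\sup_{|z|=1}|B'(z)|$ and $m(B)=\inf_{|z|=1}|B'(z)|$. *)

(* Defs.v *)
From HB Require Import structures.
From mathcomp Require Import all_boot all_order all_algebra.
From mathcomp Require Import all_classical all_reals all_analysis.
From mathcomp Require Import complex.
Import Order.TTheory GRing.Theory Num.Theory numFieldNormedType.Exports.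
Set Implicit Arguments. Unset Strict Implicit. Unset Printing Implicit Defensive.
Local Open Scope ring_scope.
Local Open Scope complex_scope.
Local Open Scope classical_set_scope.

Definition blaschke (R : realType) (alpha : R[i]) (a : seq R[i]) (z : R[i]) : R[i] :=
  alpha * \prod_(ak <- a) ((z - ak) / (1 - ak^* * z)).

Definition cderiv (R : realType) (f : R[i] -> R[i]) (z : R[i]) : R[i] :=
  derive1 (f : R[i]^o -> R[i]^o) z.

(* modulus |z| of a complex number, as an element of R
   (the MathComp norm `|z| on R[i] is the real number (sqrt(a^2+b^2))%:C) *)
Definition cabs (R : realType) (z : R[i]) : R := complex.Re `|z|.

Definition unit_circle (R : realType) : set R[i] := [set z | cabs z = 1].

Definition Mder (R : realType) (B : R[i] -> R[i]) : R :=
  sup [set cabs (cderiv B z) | z in @unit_circle R].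
Definition mder (R : realType) (B : R[i] -> R[i]) : R :=
  inf [set cabs (cderiv B z) | z in @unit_circle R].

(* Main.v *)
(* On the circle |B'(z)| = z B'(z) / B(z) is the sum S(z) of the Poisson kernels
   (1 - |c|^2) / |z - c|^2 over the zeros c of B.  Given z_0 on the circle, z B(z)
   takes the value lam = z_0 B(z_0) at exactly n + 1 points z_0, ..., z_n, all on
   the circle.  If B = N / D, the partial fraction expansion at 0 of
   D / (z N - lam D) gives sum_j 1 / (1 + S(z_j)) = 1.  Bounding all terms but the
   one at z_0 by the extreme values of S yields
     1 / (1 + w) + n / (1 + M) <= 1 <= 1 / (1 + w) + n / (1 + m)
   for every value w of |B'| on the circle; the inequalities follow from this. *)
Require Import Defs.
From HB Require Import structures.
From mathcomp Require Import all_boot all_order all_algebra.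
From mathcomp Require Import all_classical all_reals all_analysis.
From mathcomp Require Import complex.
From mathcomp Require Import separable ring lra.
Set Implicit Arguments. Unset Strict Implicit. Unset Printing Implicit Defensive.
Import Order.TTheory GRing.Theory Num.Theory numFieldNormedType.Exports.
Local Open Scope ring_scope.

(** Lagrange interpolation of [q] at the nodes [s]: the cofactor [g z] of [p] vanishes at every
    other node, and its value at [z] is that of the derivative of [p]. *)
Lemma partial_fractions (F : fieldType) (p q : {poly F}) (s : seq F) (x : F) :
    uniq s -> all (root p) s -> all (fun z => ~~ root p^`() z) s ->
    (size q <= size s)%N -> size p = (size s).+1 -> x \notin s ->
  q.[x] / p.[x] = \sum_(z <- s) q.[z] / (p^`().[z] * (x - z)).
Proof.
move=> us rs ds sq sp xs.
pose g z := p %/ ('X - z%:P).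
have gE z : z \in s -> p = g z * ('X - z%:P).
  by move=> zs; rewrite divpK // dvdp_XsubCl (allP rs).
have dgE z : z \in s -> p^`().[z] = (g z).[z].
  by move=> /gE {1}->; rewrite derivM derivXsubC !hornerE subrr mulr0 add0r.
have dN0 z : z \in s -> p^`().[z] != 0 by move=> /(allP ds).
have pN0 : p != 0 by rewrite -size_poly_eq0 sp.
pose h := \sum_(z <- s) (q.[z] / p^`().[z]) *: g z.
(* Both sides have size at most [size s] and agree at the [size s] distinct nodes. *)
have hE : q = h.
  apply/eqP; rewrite -subr_eq0; apply/eqP.
  apply: (@roots_geq_poly_eq0 _ _ s) => //; last first.
    rewrite (leq_trans (size_polyD _ _)) // geq_max sq size_polyN /=.
    apply: (leq_trans (size_sum _ _ _)); apply/bigmax_leqP_seq => z zs _.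
    apply: (leq_trans (size_scale_leq _ _)).
    by rewrite size_divp ?polyXsubC_eq0 // size_XsubC sp subn1.
  apply/allP => y ys; rewrite rootE hornerD hornerN horner_sum (bigD1_seq y) //=.
  rewrite big_seq_cond big1 ?addr0 => [|z /andP[zs zy]].
    by rewrite hornerZ -dgE // divfK ?dN0 // subrr.
  have := allP rs y ys; rewrite rootE (gE z zs) hornerM hornerXsubC mulf_eq0.
  rewrite subr_eq0 [y == z]eq_sym (negPf zy) orbF hornerZ => /eqP ->.
  by rewrite mulr0.
have pxN0 : p.[x] != 0.
  apply/negP => px; have := @max_poly_roots _ p (x :: s) pN0.
  by rewrite /= rootE px rs xs us sp ltnn => /(_ isT isT).
rewrite {1}hE horner_sum mulr_suml !big_seq; apply: eq_bigr => z zs.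
have xz : x - z != 0 by rewrite subr_eq0; apply: contraNneq xs => ->.
rewrite hornerZ invfM [RHS]mulrA -[LHS]mulrA; congr (_ * _).
apply: (mulIf pxN0); rewrite divfK // [in RHS](gE z zs) hornerM hornerXsubC.
by rewrite mulrCA mulVf // mulr1.
Qed.

(** * Blaschke products as quotients of polynomials over a closed field *)

Section BlaschkeAlgebra.
Variable C : numClosedFieldType.
Implicit Types (a : seq C) (c z lam alpha : C).

Definition bnum alpha a : {poly C} := alpha *: \prod_(c <- a) ('X - c%:P).
Definition bden a : {poly C} := \prod_(c <- a) (1 - c^* *: 'X).
Definition poisson_sum a z : C :=
  \sum_(c <- a) (1 - `|c| ^+ 2) / `|z - c| ^+ 2.

Lemma horner_bnum alpha a z : (bnum alpha a).[z] = alpha * \prod_(c <- a) (z - c).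
Proof.
rewrite hornerZ horner_prod; congr (_ * _).
by apply: eq_bigr => c _; rewrite !hornerE.
Qed.

Lemma horner_bden a z : (bden a).[z] = \prod_(c <- a) (1 - c^* * z).
Proof. by rewrite horner_prod; apply: eq_bigr => c _; rewrite !hornerE. Qed.

Lemma size_bnum alpha a : alpha != 0 -> size (bnum alpha a) = (size a).+1.
Proof. by move=> a0; rewrite size_scale // size_prod_XsubC. Qed.

(** Not an equality, since a zero [c = 0] contributes the constant factor 1. *)
Lemma size_bden a : (size (bden a) <= (size a).+1)%N.
Proof.
rewrite /bden; elim: a => [|c a IH]; first by rewrite big_nil size_poly1.
rewrite big_cons (leq_trans (size_polyMleq _ _)) //= -ltnS.
apply: (@leq_trans (2 + (size a).+1)) => //.
(* The predecessor comes from the size of a product; the sum of sizes is positive because the new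
   factor takes the value 1 at 0. *)
rewrite prednK; last first.
  rewrite addn_gt0 size_poly_gt0; apply/orP; left.
  apply/eqP => /(congr1 (fun p => p.[0])); rewrite !hornerE => /eqP.
  by rewrite ?mulr0 subr0 oner_eq0.
apply: leq_add => //; rewrite (leq_trans (size_polyD _ _)) // size_polyN.
rewrite geq_max size_poly1 /=.
by rewrite (leq_trans (size_scale_leq _ _)) // size_polyX.
Qed.

(** On the circle 1 equals [z * z^*], so [z] factors out. *)
Lemma oneB_conj_mul c z : `|z| = 1 -> 1 - c^* * z = z * (z - c)^*.
Proof.
move=> z1; rewrite rmorphB mulrBr [z * c^*]mulrC; congr (_ - _).
by rewrite -normCK z1 expr1n.
Qed.

(** For [c] in the disc, the sign of the right side decides which norm is larger, inside and outside
    the circle. *)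
Lemma sqr_norm_blaschke_factor c z :
  `|1 - c^* * z| ^+ 2 - `|z - c| ^+ 2 = (1 - `|c| ^+ 2) * (1 - `|z| ^+ 2).
Proof.
by rewrite !normCK !rmorphB rmorphM /= rmorph1 conjCK; ring.
Qed.

Lemma poisson_sum_ge0 a z : (forall c, c \in a -> `|c| < 1) ->
  0 <= poisson_sum a z.
Proof.
move=> ha; rewrite /poisson_sum big_seq; apply: sumr_ge0 => c /ha c1.
by rewrite divr_ge0 ?exprn_ge0 // subr_ge0 exprn_ile1 // ltW.
Qed.

(** Serves to bound [|B'|] on the circle, so that its supremum is a genuine one. Each kernel is
    controlled by [|z - c| >= 1 - |c|]. *)
Lemma poisson_sum_le a z : (forall c, c \in a -> `|c| < 1) -> `|z| = 1 ->
  poisson_sum a z <= \sum_(c <- a) ((1 - `|c|) ^+ 2)^-1.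
Proof.
move=> ha z1; rewrite /poisson_sum !big_seq; apply: ler_sum => c /ha c1.
have c0 : 0 < 1 - `|c| by rewrite subr_gt0.
have cz : 1 - `|c| <= `|z - c| by rewrite -z1 lerB_dist.
rewrite -[leRHS]mul1r; apply: ler_pM.
- by rewrite subr_ge0 exprn_ile1 // ltW.
- by rewrite invr_ge0 exprn_ge0.
- by rewrite gerBl exprn_ge0.
by rewrite lef_pV2 ?posrE ?exprn_gt0 ?(lt_le_trans c0) // lerXn2r // ?nnegrE // ltW.
Qed.

Section Disc.
Variables (alpha : C) (a : seq C).
Hypotheses (alpha1 : `|alpha| = 1) (ha : forall c, c \in a -> `|c| < 1).

Let circle_neq c z : `|z| = 1 -> c \in a -> z - c != 0.
Proof.
by move=> z1 /ha c1; rewrite subr_eq0; apply: contraTneq c1 => <-; rewrite z1 ltxx.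
Qed.

Lemma bden_circle_neq0 z : `|z| = 1 -> (bden a).[z] != 0.
Proof.
move=> z1; rewrite horner_bden prodf_seq_neq0; apply/allP => c ca /=.
rewrite oneB_conj_mul // mulf_neq0 ?conjC_eq0 ?circle_neq //.
by rewrite -normr_eq0 z1 oner_eq0.
Qed.

Lemma norm_blaschke_circle z : `|z| = 1 -> `|(bnum alpha a).[z]| = `|(bden a).[z]|.
Proof.
move=> z1; rewrite horner_bnum horner_bden normrM alpha1 mul1r !normr_prod.
by apply: eq_bigr => c _; rewrite oneB_conj_mul // normrM z1 mul1r norm_conjC.
Qed.

(** Together with its exterior counterpart, this confines the solutions of [z * B(z) = lam],
    [|lam| = 1], to the circle. The factors are compared weakly; the extra factor [z] gives
    strictness, even for empty [a]. *)
Lemma norm_blaschke_in z : `|z| < 1 -> `|z * (bnum alpha a).[z]| < `|(bden a).[z]|.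
Proof.
move=> z1; have h c : c \in a -> `|z - c| < `|1 - c^* * z|.
  move=> /ha c1; rewrite -(@ltr_pXn2r _ 2) ?nnegrE // -subr_gt0.
  by rewrite sqr_norm_blaschke_factor mulr_gt0 // subr_gt0 exprn_ilt1.
have d0 : 0 < `|(bden a).[z]|.
  rewrite normr_gt0 horner_bden prodf_seq_neq0; apply/allP => c ca /=.
  by rewrite -normr_gt0 (le_lt_trans _ (h c ca)).
apply: (@le_lt_trans _ _ (`|z| * `|(bden a).[z]|)); last by rewrite gtr_pMl.
rewrite normrM ler_wpM2l // horner_bnum horner_bden normrM alpha1 mul1r !normr_prod.
by rewrite !big_seq; apply: ler_prod => c ca; rewrite normr_ge0 ltW // h.
Qed.

Lemma norm_blaschke_out z : 1 < `|z| -> `|(bden a).[z]| < `|z * (bnum alpha a).[z]|.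
Proof.
move=> z1; have h c : c \in a -> `|1 - c^* * z| < `|z - c|.
  move=> /ha c1; rewrite -(@ltr_pXn2r _ 2) ?nnegrE // -subr_lt0.
  rewrite sqr_norm_blaschke_factor pmulr_rlt0 ?subr_lt0 ?exprn_egt1 //.
  by rewrite subr_gt0 exprn_ilt1.
have d0 : 0 < `|(bnum alpha a).[z]|.
  rewrite horner_bnum normrM alpha1 mul1r normr_gt0 prodf_seq_neq0.
  apply/allP => c ca /=.
  by rewrite -normr_gt0 (le_lt_trans _ (h c ca)).
rewrite normrM; apply: (@le_lt_trans _ _ `|(bnum alpha a).[z]|); last by rewrite ltr_pMl.
rewrite horner_bnum horner_bden normrM alpha1 mul1r !normr_prod.
by rewrite !big_seq; apply: ler_prod => c ca; rewrite normr_ge0 ltW // h.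
Qed.

End Disc.

(** This is [z * B' / B = S] with denominators cleared. Logarithmic derivatives add up over the
    factors, hence the induction on [a]. *)
Lemma blaschke_log_deriv alpha a z : (forall c, c \in a -> `|c| < 1) -> `|z| = 1 ->
  z * ((bnum alpha a)^`().[z] * (bden a).[z] - (bnum alpha a).[z] * (bden a)^`().[z])
  = poisson_sum a z * ((bnum alpha a).[z] * (bden a).[z]).
Proof.
move=> ha z1; rewrite /bnum derivZ !hornerZ -!mulrA -mulrBr mulrCA [RHS]mulrCA.
congr (_ * _); rewrite /bden /poisson_sum.
elim: a ha => [|c a IH] ha.
  by rewrite !big_nil -polyC1 derivC !hornerE; ring.
have cN : z - c != 0.
  rewrite subr_eq0; apply/eqP => zc; have := ha c (mem_head _ _).
  by rewrite -zc z1 ltxx.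
rewrite !big_cons.
have {}IH := IH (fun x xa => ha x (mem_behead (s := _ :: _) xa)).
move: IH; set N := \prod_(_ <- _) _; set D := \prod_(_ <- _) _; set S := \sum_(_ <- _) _.
move=> IH; rewrite !derivM !poly.derivE !hornerE /=.
(* The contribution of one factor: its logarithmic derivative has numerator [1 - c * c^*], and
   [1 - c^* * z = z * (z - c)^*] turns it into the Poisson kernel. *)
have cE : (1 - `|c| ^+ 2) / `|z - c| ^+ 2 * (z - c) * (1 - c^* * z) = z * (1 - c * c^*).
  have : (z - c)^* != 0 by rewrite conjC_eq0.
  rewrite oneB_conj_mul // !normCK rmorphB => w0; field.
  by rewrite cN w0.
move: cE; set P := _ / _ => cE.
transitivity ((z - c) * (1 - c^* * z) * (z * (N^`().[z] * D.[z] - N.[z] * D^`().[z]))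
   + z * (1 - c * c^*) * (N.[z] * D.[z])); first by ring.
by rewrite IH -cE; ring.
Qed.

Lemma sum_inv_blaschke_fiber alpha a z0 :
    `|alpha| = 1 -> (forall c, c \in a -> `|c| < 1) -> `|z0| = 1 ->
  exists s : seq C, [/\ size s = size a, all (fun z => `|z| == 1) s &
    (1 + poisson_sum a z0)^-1 + \sum_(z <- s) (1 + poisson_sum a z)^-1 = 1].
Proof.
move=> alpha1 ha z01.
have alpha0 : alpha != 0 by rewrite -normr_eq0 alpha1 oner_eq0.
set N := bnum alpha a; set D := bden a.
have DN0 z : `|z| = 1 -> D.[z] != 0 by apply: bden_circle_neq0.
pose lam := z0 * N.[z0] / D.[z0].
have lam1 : `|lam| = 1.
  rewrite /lam !normrM z01 mul1r normfV norm_blaschke_circle //.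
  by rewrite divff // normr_eq0 DN0.
have lam0 : lam != 0 by rewrite -normr_eq0 lam1 oner_eq0.
pose F := 'X * N - lam *: D.
have FE z : F.[z] = z * N.[z] - lam * D.[z] by rewrite !hornerE.
have sN : size N = (size a).+1 by rewrite size_bnum.
have sXN : size ('X * N) = (size a).+2.
  by rewrite mulrC size_mulX ?sN // -size_poly_eq0 sN.
have sD : (size D <= (size a).+1)%N := size_bden a.
(* The leading term of ['X * N] survives because [D] has smaller degree; hence [F] has [size a + 1]
   roots with multiplicity. *)
have sF : size F = (size a).+2.
  rewrite size_polyDl sXN // size_polyN.
  by rewrite (leq_ltn_trans (size_scale_leq _ _)).
have F0 : F != 0 by rewrite -size_poly_eq0 sF.
have rootF z : root F z -> `|z| = 1.
  rewrite rootE FE subr_eq0 => /eqP/(congr1 Num.norm).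
  rewrite [in RHS]normrM lam1 mul1r => h.
  have /real_ltgtP : `|z| \is Num.real by rewrite normr_real.
  move=> /(_ 1 (real1 _)) [] // z1.
    by have := norm_blaschke_in alpha1 ha z1; rewrite h ltxx.
  by have := norm_blaschke_out alpha1 ha z1; rewrite h ltxx.
have S1 z : 1 + poisson_sum a z != 0.
  by rewrite gt_eqF // ltr_pwDl // poisson_sum_ge0.
(* At a root [lam * D] may be replaced by [z * N], which brings out the logarithmic derivative of
   [B]. As [1 + S] is positive, every root is simple. *)
have dF z : root F z -> z * F^`().[z] = lam * D.[z] * (1 + poisson_sum a z).
  move=> Fz; have z1 := rootF z Fz; have Dz := DN0 z z1.
  move: Fz; rewrite rootE FE subr_eq0 => /eqP Fz.
  apply: (mulIf Dz); have := blaschke_log_deriv alpha ha z1.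
  rewrite -/N -/D => h.
  have -> : F^`().[z] = N.[z] + z * N^`().[z] - lam * D^`().[z].
    rewrite derivB derivM derivX mul1r [(lam *: _)^`()]derivZ hornerD hornerN.
    by rewrite [(lam *: _).[z]]hornerZ hornerD hornerM hornerX.
  have -> : z * (N.[z] + z * N^`().[z] - lam * D^`().[z]) * D.[z]
     = z * N.[z] * D.[z] + z * (z * N^`().[z] * D.[z]) - z * D^`().[z] * (lam * D.[z]).
    by ring.
  rewrite -Fz.
  transitivity (z * N.[z] * D.[z] + z * (z * (N^`().[z] * D.[z] - N.[z] * D^`().[z]))).
    by ring.
  by rewrite h; ring.
have dF0 z : root F z -> F^`().[z] != 0.
  move=> Fz; have z1 := rootF z Fz.
  have : z * F^`().[z] != 0 by rewrite dF // mulf_neq0 ?S1 // mulf_neq0 ?DN0.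
  by rewrite mulf_eq0 negb_or => /andP[].
have [r Fr] := closed_field_poly_normal F.
have lF : lead_coef F != 0 by rewrite lead_coef_eq0.
have rootr z : root F z = (z \in r) by rewrite Fr rootZ // root_prod_XsubC.
have ur : uniq r.
  rewrite -separable_prod_XsubC -(@eqp_separable _ F); last first.
    by rewrite Fr eqp_scale.
  by rewrite unlock; apply/Pdiv.ClosedField.coprimepP => z /dF0.
have sr : size r = (size a).+1.
  by move: sF; rewrite Fr size_scale // size_prod_XsubC => -[].
have r0 : 0 \notin r.
  by rewrite -rootr; apply/negP => /rootF/eqP; rewrite normr0 eq_sym oner_eq0.
have z0r : z0 \in r.
  by rewrite -rootr rootE FE /lam divfK ?subrr // DN0.
exists (rem z0 r); split.
- by rewrite size_rem // sr.
- by apply/allP => z /mem_rem; rewrite -rootr => /rootF ->.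
transitivity (\sum_(z <- r) (1 + poisson_sum a z)^-1).
  by rewrite (big_rem z0 z0r).
(* At 0 the quotient [D / F] equals [- 1 / lam]; 0 is no root since all roots have modulus 1. *)
have := @partial_fractions _ F D r 0 ur _ _ _ _ r0.
rewrite sr sF FE mul0r sub0r => /(_ _ _ sD erefl).
have D0 : D.[0] = 1 by rewrite horner_bden big1 // => c _; rewrite mulr0 subr0.
rewrite D0 mulr1 => h.
have {}h : 1 / - lam = \sum_(z <- r) D.[z] / (F^`().[z] * (0 - z)).
  apply: h; apply/allP => z; rewrite -rootr // => /dF0.
  by rewrite rootE.
have {}h : 1 = \sum_(z <- r) - lam * (D.[z] / (F^`().[z] * (0 - z))).
  by rewrite -mulr_sumr -h mulrCA divff ?oppr_eq0 // mulr1.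
rewrite [RHS]h !big_seq; apply: eq_bigr => z zr.
have Fz : root F z by rewrite rootr.
have z1 := rootF z Fz.
(* By [dF], the term [lam * D(z) / (z * F'(z))] is exactly [1 / (1 + S(z))]. *)
rewrite sub0r mulrN [_ * z]mulrC dF // invrN mulrN mulrNN invfM !mulrA.
by rewrite divff ?mul1r // mulf_neq0 // DN0.
Qed.
End BlaschkeAlgebra.

(** * The complex derivative of a Blaschke product on the circle *)

Local Open Scope complex_scope.

Lemma is_derive_horner (K : numFieldType) (p : {poly K}) (x : K) :
  is_derive (x : K^o) (1 : K^o) (horner p : K^o -> K^o) p^`().[x].
Proof.
elim/poly_ind: p => [|p c IH].
  rewrite deriv0 horner0.
  have -> : horner (0 : {poly K}) = cst 0 by apply/funext => y; rewrite horner0.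
  exact: is_derive_cst.
have -> : horner (p * 'X + c%:P) = (horner p : K^o -> K^o) * (id : K^o -> K^o) + cst (c : K^o).
  by apply/funext => y; rewrite !hornerE.
apply: is_derive_eq.
by rewrite poly.derivE !hornerE /GRing.scale /= mulr1 [x * _]mulrC.
Qed.

Lemma derive_horner_div (K : numFieldType) (p q : {poly K}) (x : K) : q.[x] != 0 ->
  'D_(1 : K^o) ((fun y => p.[y] / q.[y]) : K^o -> K^o) (x : K^o) =
  (p^`().[x] * q.[x] - p.[x] * q^`().[x]) / q.[x] ^+ 2.
Proof.
move=> qx0; have [dp ep] := is_derive_horner p x.
have [dq eq] := is_derive_horner q x.
have dqV : derivable ((fun y : K^o => (q.[y])^-1) : K^o -> K^o) (x : K^o) (1 : K^o).
  exact: derivableV.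
have -> : ((fun y => p.[y] / q.[y]) : K^o -> K^o) =
    (horner p : K^o -> K^o) * ((fun y : K^o => (q.[y])^-1) : K^o -> K^o).
  by apply/funext.
rewrite (deriveM dp dqV) (deriveV _ dq) // ep eq /GRing.scale /=.
by field.
Qed.

Lemma blaschkeE (R : realType) (alpha : R[i]) (a : seq R[i]) (z : R[i]) :
  blaschke alpha a z = (bnum alpha a).[z] / (bden a).[z].
Proof. by rewrite /blaschke horner_bnum horner_bden prodf_div mulrA. Qed.

Lemma cderiv_blaschke (R : realType) (alpha : R[i]) (a : seq R[i]) (z : R[i]) :
    (forall c, c \in a -> `|c| < 1) -> `|z| = 1 ->
  z * cderiv (blaschke alpha a) z = poisson_sum a z * blaschke alpha a z.
Proof.
move=> ha z1; have Dz := bden_circle_neq0 ha z1.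
have -> : blaschke alpha a = fun y => (bnum alpha a).[y] / (bden a).[y].
  by apply/funext => y; rewrite blaschkeE.
rewrite /cderiv derive1E (derive_horner_div _ Dz) mulrA blaschke_log_deriv //.
by rewrite -mulrA; congr (_ * _); field.
Qed.

Lemma cabsE (R : realType) (z : R[i]) : (cabs z)%:C = `|z|.
Proof. by rewrite /cabs RRe_real // normr_real. Qed.

(** Take norms in [z * B' = S * B], where [z] and [B] have modulus 1 and [S] is nonnegative. *)
Lemma cabs_cderiv_blaschke (R : realType) (alpha : R[i]) (a : seq R[i]) (z : R[i]) :
    `|alpha| = 1 -> (forall c, c \in a -> `|c| < 1) -> `|z| = 1 ->
  (cabs (cderiv (blaschke alpha a) z))%:C = poisson_sum a z.
Proof.
move=> alpha1 ha z1; rewrite cabsE -[LHS]mul1r -{1}z1 -normrM cderiv_blaschke //.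
rewrite normrM ger0_norm ?poisson_sum_ge0 // blaschkeE normf_div.
rewrite norm_blaschke_circle // divff ?mulr1 // normr_eq0.
exact: bden_circle_neq0.
Qed.

(** * Real inequalities from the reciprocal sums, and their application to [|B'|] *)

Lemma sup_inf_of_reciprocal_sums (R : realType) (E : set R) (n : nat) :
    (0 < n)%N -> (E !=set0)%classic -> has_ubound E -> (forall w, E w -> 0 <= w) ->
    (forall w, E w -> exists s : seq R,
      [/\ size s = n, (forall y, y \in s -> E y) &
          (1 + w)^-1 + \sum_(y <- s) (1 + y)^-1 = 1]) ->
  n%:R / (sup E - n%:R + 1) <= inf E /\ inf E <= n%:R - 1 + n%:R / sup E /\
  0 < inf E /\ inf E <= n%:R /\ n%:R <= sup E.
Proof.
move=> n_gt0 E0 Eub E_ge0 Esum.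
set M := sup E; set m := inf E; have Elb : has_lbound E by exists 0.
have wM w : E w -> w <= M by move=> Ew; apply: ub_le_sup.
have mw w : E w -> m <= w by move=> Ew; apply: ge_inf.
have m0 : 0 <= m by apply: lb_le_inf.
have n1 : 1 <= n%:R :> R by rewrite ler1n.
have M0 : 0 <= M by have [w Ew] := E0; apply: le_trans (wM w Ew); apply: E_ge0.
have bounds w : E w -> (1 + w)^-1 + n%:R / (1 + M) <= 1 <= (1 + w)^-1 + n%:R / (1 + m).
  move=> Ew; have [s [ss sE e]] := Esum w Ew.
  have cst (x : R) : n%:R / x = \sum_(y <- s) x^-1.
    by rewrite big_const_seq count_predT iter_addr_0 ss mulr_natl.
  have lo : n%:R / (1 + M) <= \sum_(y <- s) (1 + y)^-1.
    rewrite cst !big_seq; apply: ler_sum => y /sE Ey.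
    by rewrite lef_pV2 ?posrE ?lerD2l ?wM // ltr_pwDl // E_ge0.
  have hi : \sum_(y <- s) (1 + y)^-1 <= n%:R / (1 + m).
    rewrite cst !big_seq; apply: ler_sum => y /sE Ey.
    by rewrite lef_pV2 ?posrE ?lerD2l ?mw // ltr_pwDl // E_ge0.
  by apply/andP; split; lra.
(* The two bounds with [1 - 1 / (1 + w) = w / (1 + w)] inserted and denominators cleared. *)
have prod w : E w -> n%:R * (1 + w) <= w * (1 + M) /\ w * (1 + m) <= n%:R * (1 + w).
  move=> Ew; have w0 := E_ge0 w Ew; have /andP[h1 h2] := bounds w Ew.
  have e : 1 - (1 + w)^-1 = w / (1 + w) by field; lra.
  split.
    have : n%:R / (1 + M) <= w / (1 + w) by lra.
    by rewrite ler_pdivrMr ?ltr_pwDl // mulrAC ler_pdivlMr ?ltr_pwDl.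
  have : w / (1 + w) <= n%:R / (1 + m) by lra.
  by rewrite ler_pdivlMr ?ltr_pwDl // mulrAC ler_pdivrMr ?ltr_pwDl.
(* If [M < n], the first product bound forces [n <= w <= M], a contradiction; the bound on [m] is
   symmetric. *)
have nM : n%:R <= M.
  have [w Ew] := E0; have [h _] := prod w Ew; have := wM w Ew; have := E_ge0 w Ew.
  nra.
have mn : m <= n%:R.
  have [w Ew] := E0; have [_ h] := prod w Ew; have := mw w Ew; have := E_ge0 w Ew.
  nra.
(* The first product bound reads [n <= w * (M - n + 1)], with a factor at least 1 by [nM]. *)
have lo : n%:R / (M - n%:R + 1) <= m.
  apply: lb_le_inf => // w Ew; have [h _] := prod w Ew.
  by rewrite ler_pdivrMr; [lra|lra].
split=> //; split; last first.
  split=> //; apply: lt_le_trans lo; apply: divr_gt0; lra.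
(* The second product bound reads [w * (m - n + 1) <= n], which bounds [w] only when that factor is
   positive; otherwise the claim follows from [n / M >= 0]. *)
have [h|m_gt] := leP m (n%:R - 1).
  by rewrite (le_trans h) // lerDl divr_ge0.
have : M <= n%:R / (m - n%:R + 1).
  apply: ge_sup => // w Ew; have [_ h] := prod w Ew.
  by rewrite ler_pdivlMr; lra.
rewrite ler_pdivlMr; last lra.
move=> h; rewrite -lerBlDl ler_pdivlMr; lra.
Qed.

Theorem theorem1 (R : realType) (alpha : R[i]) (a : seq R[i]) (n : nat) :
  size a = n -> (1 <= n)%N ->
  cabs alpha = 1 ->
  (forall ak, ak \in a -> cabs ak < 1) ->
  let B := blaschke alpha a in
  let M := Mder B in
  let m := mder B in
  n%:R / (M - n%:R + 1) <= m /\ m <= n%:R - 1 + n%:R / M /\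
  0 < m /\ m <= n%:R /\ n%:R <= M.
Proof.
move=> sa n_gt0 /(congr1 (real_complex R)); rewrite cabsE => alpha1 ha0 B.
have ha c : c \in a -> `|c| < 1 by move=> /ha0; rewrite -ltcR cabsE.
have circle (z : R[i]) : (cabs z = 1) <-> (`|z| = 1).
  by rewrite -cabsE; split=> [->|/complexI].
have wE z : `|z| = 1 -> (cabs (cderiv B z))%:C = poisson_sum a z.
  exact: cabs_cderiv_blaschke.
have wVE z : `|z| = 1 ->
    ((1 + cabs (cderiv B z))^-1)%:C = (1 + poisson_sum a z)^-1.
  by move=> z1; rewrite -wE // fmorphV rmorphD rmorph1.
apply: sup_inf_of_reciprocal_sums => //.
- by exists (cabs (cderiv B 1)), 1 => //; apply/circle; rewrite normr1.
(* The bound from [poisson_sum_le] lies in [R[i]]; being real, it is recovered from its real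
   part. *)
- exists (complex.Re (\sum_(c <- a) ((1 - `|c|) ^+ 2)^-1)) => _ [z /circle z1 <-].
  have := poisson_sum_le ha z1; rewrite -wE // => h.
  rewrite -lecR RRe_real // ger0_real // (le_trans _ h) // wE //.
  exact: poisson_sum_ge0.
- by move=> _ [z _ <-]; rewrite -lecR cabsE normr_ge0.
move=> _ [z /circle z1 <-].
have [s [ss s1 sE]] := sum_inv_blaschke_fiber alpha1 ha z1.
exists [seq cabs (cderiv B y) | y <- s]; split.
- by rewrite size_map ss.
- move=> _ /mapP[y ys ->]; exists y => //; apply/circle/eqP; exact: (allP s1).
(* The identity is checked in [R[i]], where the fibre sum was computed, through the injective
   embedding of [R]. *)
apply: complexI; rewrite big_map rmorphD rmorph_sum [RHS]rmorph1 -[RHS]sE.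
congr (_ + _); first exact: wVE.
by rewrite !big_seq; apply: eq_bigr => y ys; apply/wVE/eqP/(allP s1).
Qed.
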